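(* Let $A=\sigma(R)\langle x_1,\ldots,x_n\rangle$ be a bijective and quasi-commutative skew PBW extension of a ring $R$. If $R$ is a left Ore domain and $\nu:Q(A)^*\rightarrow\Gamma$ is a valuation with $\nu(Q(R)^* )=0$, then $\Gamma$ is abelian.
   Context: Skew PBW extension: let $R\subseteq A$ be rings. $A$ is a skew PBW extension of $R$, written $A=\sigma(R)\langle x_1,\ldots,x_n\rangle$, if there are finitely many elements $x_1,\ldots,x_n\in A$ such that $A$ is a free left $R$-module with basis $\{x^u=x_1^{u_1}\cdots x_n^{u_n}: u\in\mathbb{N}^n\}$ (with $x_1^0\cdots x_n^0=1$); for every $1\le i\le n$ and $r\in R\setminus\{0\}$ there is $c_{i,r}\in R\setminus\{0\}$ with $x_ir-c_{i,r}x_i\in R$; and for all $1\le i,j\le n$ there is $c_{i,j}\in R\setminus\{0\}$ with $x_jx_i-c_{i,j}x_ix_j\in R+Rx_1+\cdots+Rx_n$. Then for each $i$ there are an injective ring endomorphism $\sigma_i:R\to R$ and a $\sigma_i$-derivation $\delta_i:R\to R$ with $x_ir=\sigma_i(r)x_i+\delta_i(r)$ for all $r\in R$. $A$ is quasi-commutative if for every $i$ and every $r\in R\setminus\{0\}$ there is $c_{i,r}\in R\setminus\{0\}$ with $x_ir=c_{i,r}x_i$, and for all $i,j$ there is $c_{i,j}\in R\setminus\{0\}$ with $x_jx_i=c_{i,j}x_ix_j$. $A$ is bijective if every $\sigma_i$ is bijective and $c_{i,j}$ is invertible for all $1\le i<j\le n$. For a left Ore domain $B$, $Q(B)$ denotes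 its total division ring of (left) fractions. If $R$ is a left Ore domain and $A$ is a bijective quasi-commutative skew PBW extension of $R$, then $A$ is a left Ore domain and $Q(R)$ is regarded as a division subring of $Q(A)$. Valuation: for a division ring $D$ and a totally ordered group $\Gamma$ (written additively, not necessarily commutative), a valuation $\nu:D^*\to\Gamma$ is a surjective map with $\nu(ab)=\nu(a)+\nu(b)$ for all $a,b\in D^*$ and $\nu(a+b)\ge\min\{\nu(a),\nu(b)\}$ whenever $a,b,a+b\in D^*$. *)

(* Defs.v *)
From HB Require Import structures.
From mathcomp Require Import all_boot all_order all_algebra.

Set Implicit Arguments.
Unset Strict Implicit.
Unset Printing Implicit Defensive.

Import Order.TTheory GRing.Theory.
Local Open Scope ring_scope.

(** Totally ordered groups.  MathComp's additive structures are commutative,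
    so the possibly non-abelian value group is a [groupType] and is written
    multiplicatively: [(g * h)%g] is the paper's g + h and [1%g] its 0. *)

HB.mixin Record isOrderedGroup (d : Order.disp_t) T
    of Order.Total d T & Group T := {
  le_mulg2l : forall g h k : T, (h <= k)%O -> ((g * h)%g <= (g * k)%g)%O;
  le_mulg2r : forall g h k : T, (h <= k)%O -> ((h * g)%g <= (k * g)%g)%O
}.

#[short(type="orderedGroupType")]
HB.structure Definition OrderedGroup (d : Order.disp_t) :=
  {T of isOrderedGroup d T & Order.Total d T & Group T}.

(** Left Ore domains and their division rings of left fractions *)

Definition left_ore_domain (R : nzRingType) : Prop :=
  (forall a b : R, a * b = 0 -> a = 0 \/ b = 0) /\
  (forall a b : R, a != 0 -> b != 0 ->
     exists r s : R, r * a = s * b /\ r * a != 0).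

Definition left_fraction (B : nzRingType) (D : unitRingType) (f : B -> D)
    (d : D) : Prop :=
  exists s b : B, s != 0 /\ d = (f s)^-1 * f b.

(** [D], with the embedding [f], is Q(B).  [GRing.field_axiom] only says that
    nonzero elements are units; [D] need not be commutative. *)
Record division_ring_of_fractions (B : nzRingType) (D : unitRingType)
    (f : {rmorphism B -> D}) : Prop := {
  fractions_division_ring : GRing.field_axiom D;
  fractions_injective : injective f;
  fractions_surjective : forall d : D, left_fraction f d
}.

Definition left_basis (R : nzRingType) (V : lmodType R) (I : eqType)
    (b : I -> V) : Prop :=
  (forall (s : seq I) (c : I -> R), uniq s ->
     \sum_(i <- s) c i *: b i = 0 -> forall i, i \in s -> c i = 0) /\
  (forall v : V, exists (s : seq I) (c : I -> R),
     uniq s /\ v = \sum_(i <- s) c i *: b i).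

(** Skew PBW extensions.  A [lalgType R] is a ring [A] with a ring morphism
    [r |-> r%:A] from [R], the left module structure being
    [r *: a = r%:A * a]; [R] is central only in an [algType]. *)
Section SkewPBW.
Variables (R : nzRingType) (A : lalgType R) (n : nat) (x : 'I_n -> A).

(** The factors are multiplied in increasing order of [i]. *)
Definition standard_monomial (u : {ffun 'I_n -> nat}) : A :=
  \prod_(i < n) x i ^+ u i.

Definition linear_part (a : A) : Prop :=
  exists (r0 : R) (r : 'I_n -> R), a = r0%:A + \sum_(i < n) r i *: x i.

Record skew_PBW_extension : Prop := {
  skewPBW_subring : injective (fun r : R => r%:A : A);
  skewPBW_basis : left_basis standard_monomial;
  skewPBW_coef : forall (i : 'I_n) (r : R), r != 0 ->
    exists c : R, c != 0 /\
      exists r' : R, x i * r%:A - c%:A * x i = r'%:A;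
  skewPBW_vars : forall i j : 'I_n,
    exists c : R, c != 0 /\ linear_part (x j * x i - c%:A * x i * x j)
}.

Definition skew_derivation (sigma delta : R -> R) : Prop :=
  (forall r s, delta (r + s) = delta r + delta s) /\
  (forall r s, delta (r * s) = sigma r * delta s + delta r * s).

(** [sigma] is sigma_i and [delta] is delta_i; in a skew PBW extension they
    exist and are unique, by freeness over the standard monomials. *)
Definition structure_maps (i : 'I_n) (sigma : {rmorphism R -> R})
    (delta : R -> R) : Prop :=
  [/\ injective sigma, skew_derivation sigma delta &
      forall r : R, x i * r%:A = (sigma r)%:A * x i + (delta r)%:A].

Definition quasi_commutative : Prop :=
  (forall (i : 'I_n) (r : R), r != 0 ->
     exists c : R, c != 0 /\ x i * r%:A = c%:A * x i) /\
  (forall i j : 'I_n,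
     exists c : R, c != 0 /\ x j * x i = c%:A * x i * x j).

Definition two_sided_invertible (c : R) : Prop :=
  exists d : R, d * c = 1 /\ c * d = 1.

(** For [i < j] the constant c_{i,j} is unique, [x i * x j] being a standard
    monomial. *)
Definition bijective_extension : Prop :=
  (forall i : 'I_n, exists (sigma : {rmorphism R -> R}) (delta : R -> R),
     structure_maps i sigma delta /\ bijective sigma) /\
  (forall i j : 'I_n, (i < j)%N ->
     exists c : R, two_sided_invertible c /\
       linear_part (x j * x i - c%:A * x i * x j)).

End SkewPBW.

(** Valuations are total functions on [D]; the value at 0 is irrelevant. *)
Record valuation (D : unitRingType) (d : Order.disp_t)
    (G : orderedGroupType d) (nu : D -> G) : Prop := {
  valuation_surj : forall g : G, exists a : D, a != 0 /\ nu a = g;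
  valuationM : forall a b : D, a != 0 -> b != 0 ->
    nu (a * b) = (nu a * nu b)%g;
  valuationD : forall a b : D, a != 0 -> b != 0 -> a + b != 0 ->
    (Order.min (nu a) (nu b) <= nu (a + b))%O
}.

(* Main.v *)
Require Import Defs.
From mathcomp Require Import all_boot all_order all_algebra.

Set Implicit Arguments.
Unset Strict Implicit.
Unset Printing Implicit Defensive.

Import Order.TTheory GRing.Theory.
Local Open Scope ring_scope.

(** The division ring Q(A) is reached from Q(R) by adjoining the images of the x_k one
    at a time: if E is the division subring obtained so far and y = x_k, the
    next one consists of the left fractions of the ring E[y] of left
    polynomials in y over E.  Each x_j conjugates E into itself and
    x_j y = c y x_j with c in E, so the shape of the situation is preserved.
    The invariant ([adapted]) is that the values of nonzero elements of E
    commute with each other and with every nu(x_j).  At the start all values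
    on Q(R) are trivial, and nu(x_i), nu(x_j) commute because c has value 0.

    The inductive step rests on the ultrametric inequality.

    Suppose conjugation by an element of value h turns nu(p) into nu(p'), where
    p' and p have the same degree; scaling p' by an element of E, of trivial
    value here, makes p' - p of smaller degree.  If p and
    p' had different values, then one of the two values would be that of
    p' - p, which commutes with h by induction on the degree; but as nu(p') is
    the conjugate of nu(p) by h, if one commutes with h they are equal.
    Hence h commutes with nu(p) in every case ([commute_of_conjugate]).  With
    conjugation by x_j this shows that nu(x_j) commutes with the values on
    E[y] ([centralizes_poly_lt]).

    To see that values on E[y] commute with each other, suppose this in degree
    less than m, let p be monic of degree m and a of smaller degree, and
    divide: p a = b p + r, where b has the degree of a and r has degree less
    than m.  If nu(p a) and nu(b p) differ, then one of them is nu(r), so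
    nu(p) is a quotient of values in degree less than m and commutes with
    nu(a).  Otherwise nu(b) is the conjugate of nu(a) by nu(p), and the
    previous argument applies, by induction on the degree of a
    ([monic_centralizes]).  Finally two monic p, q of degree m either have the
    same value, or one of nu(p), nu(q) is the value of p - q, which has degree
    less than m ([commuting_poly_lt]). *)

(** * Division subrings and left fractions *)

Section DivisionSubrings.
Variable D : unitRingType.
Hypothesis divD : GRing.field_axiom D.

(** Subsets are Prop-valued predicates: membership in a ring of fractions is
    an existential statement, with no boolean decision procedure. *)
Record subring (S : D -> Prop) : Prop := {
  subring1 : S 1;
  subringB : forall a b, S a -> S b -> S (a - b);
  subringM : forall a b, S a -> S b -> S (a * b)
}.

Record division_subring (E : D -> Prop) : Prop := {
  divsub_subring :> subring E;
  divsubV : forall a, E a -> E a^-1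
}.

Lemma divring_mulVK (a b : D) : a != 0 -> a^-1 * (a * b) = b.
Proof. by move=> a0; rewrite mulKr ?divD. Qed.

Lemma divring_invM (a b : D) : a != 0 -> b != 0 -> (a * b)^-1 = b^-1 * a^-1.
Proof. by move=> a0 b0; rewrite invrM ?divD. Qed.

Lemma divring_inv_neq0 (a : D) : a != 0 -> a^-1 != 0.
Proof.
by move=> a0; apply/negP => /eqP e; have := mulVr (divD a0);
   rewrite e mul0r => /esym/eqP; rewrite oner_eq0.
Qed.

Lemma divring_mul_neq0 (a b : D) : a != 0 -> b != 0 -> a * b != 0.
Proof.
move=> a0 b0; apply/negP => /eqP e; have := divring_mulVK b a0.
by rewrite e mulr0 => /esym/eqP; rewrite (negbTE b0).
Qed.

Lemma divring_mul_neq0P (a b : D) : a * b != 0 -> a != 0 /\ b != 0.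
Proof.
move=> h; split; apply: contraNN h => /eqP ->; first by rewrite mul0r.
by rewrite mulr0.
Qed.

Lemma divring_exp_neq0 (a : D) k : a != 0 -> a ^+ k != 0.
Proof.
move=> a0; elim: k => [|k IH]; first by rewrite expr0 oner_eq0.
by rewrite exprS divring_mul_neq0.
Qed.

Section SubringTheory.
Variable S : D -> Prop.
Hypothesis sS : subring S.

Lemma subring0 : S 0.
Proof. by rewrite -(subrr 1); apply: (subringB sS); apply: subring1. Qed.

Lemma subringN a : S a -> S (- a).
Proof. by move=> h; rewrite -sub0r; apply: (subringB sS) => //; exact: subring0. Qed.

Lemma subringD a b : S a -> S b -> S (a + b).
Proof.
by move=> ha hb; rewrite -(opprK b); apply: (subringB sS) => //; apply: subringN.
Qed.

Lemma subringX a k : S a -> S (a ^+ k).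
Proof.
move=> ha; elim: k => [|k IH]; first by rewrite expr0; apply: subring1.
by rewrite exprS; apply: (subringM sS).
Qed.

Lemma subring_sum (I : Type) (r : seq I) (F : I -> D) :
  (forall i, S (F i)) -> S (\sum_(i <- r) F i).
Proof. by move=> h; apply: (big_ind S subring0 subringD) => i _. Qed.

Lemma subring_prod (I : Type) (r : seq I) (F : I -> D) :
  (forall i, S (F i)) -> S (\prod_(i <- r) F i).
Proof. by move=> h; apply: (big_ind S (subring1 sS) (@subringM _ sS)) => i _. Qed.
End SubringTheory.

Section Fractions.
Variable S : D -> Prop.
Hypothesis sS : subring S.

Definition left_ore : Prop :=
  forall a b, S a -> S b -> b != 0 ->
    exists s r, [/\ S s, S r, s != 0 & s * a = r * b].

Definition fractions (d : D) : Prop :=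
  exists s b, [/\ S s, S b, s != 0 & d = s^-1 * b].

Lemma fractions_sub a : S a -> fractions a.
Proof.
move=> ha; exists 1, a; split=> //; first exact: subring1.
  exact: oner_neq0.
by rewrite invr1 mul1r.
Qed.

Hypothesis oreS : left_ore.

(** A left common multiple [s * p1 = r * p2] serves as common denominator in a
    difference, and [s * q1 = r * p2] moves a denominator past a numerator in a
    product. *)
Lemma fractions_division_subring : division_subring fractions.
Proof.
split; first split.
- by apply: fractions_sub; apply: subring1.
- move=> _ _ [p1 [q1 [hp1 hq1 p10 ->]]] [p2 [q2 [hp2 hq2 p20 ->]]].
  have [s [r [hs hr s0 e]]] := oreS hp1 hp2 p20.
  have sp0 : s * p1 != 0 by apply: divring_mul_neq0.
  have [r0 _] : r != 0 /\ p2 != 0 by apply: divring_mul_neq0P; rewrite -e.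
  exists (s * p1), (s * q1 - r * q2); split=> //; first exact: (subringM sS).
    by apply: (subringB sS); apply: (subringM sS).
  rewrite mulrBr {2}e !divring_invM // -!mulrA.
  by rewrite (divring_mulVK _ s0) (divring_mulVK _ r0).
- move=> _ _ [p1 [q1 [hp1 hq1 p10 ->]]] [p2 [q2 [hp2 hq2 p20 ->]]].
  have [s [r [hs hr s0 e]]] := oreS hq1 hp2 p20.
  exists (s * p1), (r * q2); split; try exact: (subringM sS).
    exact: divring_mul_neq0.
  rewrite divring_invM // -!mulrA; congr (_ * _).
  have -> : q1 = s^-1 * (r * p2) by rewrite -e divring_mulVK.
  by rewrite -!mulrA mulVKr // divD.
- move=> _ [p [q [hp hq p0 ->]]].
  have [->|q0] := eqVneq q 0.
    rewrite mulr0 invr0; exact: (fractions_sub (subring0 sS)).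
  exists q, p; split=> //.
  by rewrite divring_invM ?divring_inv_neq0 // invrK.
Qed.
End Fractions.

(** For nonzero [z] this says that conjugation by [z] maps [S] into itself; an
    inclusion is enough, since elements of [S] are only ever moved from the
    right of [z] to its left. *)
Definition normalizes (z : D) (S : D -> Prop) : Prop :=
  forall a, S a -> exists2 b, S b & z * a = b * z.

Lemma normalizes_neq0 (z a b : D) : z != 0 -> a != 0 -> z * a = b * z -> b != 0.
Proof.
move=> z0 a0 e; have : z * a != 0 by apply: divring_mul_neq0.
by rewrite e => /divring_mul_neq0P[].
Qed.

Lemma normalizesX z S k : normalizes z S -> normalizes (z ^+ k) S.
Proof.
move=> h; elim: k => [|k IH] a ha; first by exists a; rewrite ?expr0 ?mul1r ?mulr1.
have [b hb eb] := IH _ ha; have [c hc ec] := h _ hb.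
by exists c => //; rewrite exprS -mulrA eb mulrA ec mulrA.
Qed.

Lemma normalizes_fractions z S :
  z != 0 -> normalizes z S -> normalizes z (fractions S).
Proof.
move=> z0 h _ [p [q [hp hq p0 ->]]].
have [p' hp' ep] := h _ hp; have [q' hq' eq] := h _ hq.
have p'0 := normalizes_neq0 z0 p0 ep.
exists (p'^-1 * q'); first by exists p', q'.
rewrite -mulrA -eq mulrA [RHS]mulrA; congr (_ * _).
by apply: (mulrI (divD p'0)); rewrite mulrA -ep mulrK ?divD // mulVKr ?divD.
Qed.

(** * Left polynomials in a normalizing element *)

Section Polynomials.
Variables (E : D -> Prop) (y : D).
Hypothesis dE : division_subring E.
Hypothesis y0 : y != 0.
Hypothesis yE : normalizes y E.

(** Sums of [e_i * y ^+ i] with [i < m] and [e_i] in [E].  The powers of [y]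
    may be dependent over [E]: the degree arguments only use that some
    expression of bounded length exists. *)
Fixpoint poly_lt (m : nat) (p : D) : Prop :=
  if m is k.+1 then exists e q, [/\ E e, poly_lt k q & p = e * y ^+ k + q]
  else p = 0.

Definition polys (p : D) : Prop := exists m, poly_lt m p.

Lemma poly_lt0 m : poly_lt m 0.
Proof.
elim: m => [|m IH] //=; exists 0, 0; split=> //; first exact: (subring0 dE).
by rewrite mul0r addr0.
Qed.

Lemma poly_ltS m p : poly_lt m p -> poly_lt m.+1 p.
Proof.
move=> h; exists 0, p; split=> //; first exact: (subring0 dE).
by rewrite mul0r add0r.
Qed.

Lemma poly_lt_leq m k p : (m <= k)%N -> poly_lt m p -> poly_lt k p.
Proof.
by move=> /subnK <- h; elim: (k - m)%N => // i IH; apply: poly_ltS.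
Qed.

Lemma poly_ltB m p q : poly_lt m p -> poly_lt m q -> poly_lt m (p - q).
Proof.
elim: m p q => [|m IH] p q /= => [->->|]; first by rewrite subrr.
move=> [e [p' [he hp ->]]] [e' [q' [he' hq ->]]].
exists (e - e'), (p' - q'); split; [exact: (subringB dE) | exact: IH |].
by rewrite mulrBl opprD addrACA.
Qed.

Lemma poly_ltN m p : poly_lt m p -> poly_lt m (- p).
Proof. by move=> h; rewrite -sub0r; apply: poly_ltB => //; apply: poly_lt0. Qed.

Lemma poly_ltD m p q : poly_lt m p -> poly_lt m q -> poly_lt m (p + q).
Proof. by move=> hp hq; rewrite -(opprK q); apply: poly_ltB => //; apply: poly_ltN. Qed.

Lemma poly_ltZ m e p : E e -> poly_lt m p -> poly_lt m (e * p).
Proof.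
move=> he; elim: m p => [|m IH] p /= => [->|]; first by rewrite mulr0.
move=> [e' [p' [he' hp ->]]]; exists (e * e'), (e * p'); split.
- exact: (subringM dE).
- exact: IH.
- by rewrite mulrDr mulrA.
Qed.

Lemma poly_ltXl m p : poly_lt m p -> poly_lt m.+1 (y * p).
Proof.
elim: m p => [|m IH] p => [->|]; first by rewrite mulr0; apply: poly_lt0.
move=> [e [q [he hq ->]]]; have [e' he' ee] := yE he.
exists e', (y * q); split=> //; first exact: IH.
by rewrite mulrDr mulrA ee -mulrA -exprS.
Qed.

Lemma poly_ltXnl m k p : poly_lt m p -> poly_lt (k + m) (y ^+ k * p).
Proof.
move=> h; elim: k => [|k IH]; first by rewrite expr0 mul1r.
by rewrite exprS -mulrA; apply: poly_ltXl.
Qed.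

(** The bound is the exact one for a product, [k] bounding the degree of [q]. *)
Lemma poly_ltM m k p q :
  poly_lt m p -> poly_lt k.+1 q -> poly_lt (m + k) (p * q).
Proof.
elim: m p => [|m IH] p => [->|]; first by rewrite mul0r => _; apply: poly_lt0.
move=> [e [p' [he hp ->]]] hq; rewrite mulrDl -mulrA addSnnS.
apply: poly_ltD; first by apply: poly_ltZ => //; apply: poly_ltXnl.
by rewrite addnS; apply: poly_ltS; apply: IH.
Qed.

Lemma poly_lt_monom m e : E e -> poly_lt m.+1 (e * y ^+ m).
Proof. by move=> he; exists e, 0; rewrite addr0; split=> //; apply: poly_lt0. Qed.

Lemma poly_lt_const m e : E e -> poly_lt m.+1 e.
Proof.
move=> he; apply: (@poly_lt_leq 1) => //.
by have := poly_lt_monom 0 he; rewrite expr0 mulr1.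
Qed.

Lemma polys_subring : subring polys.
Proof.
split.
- by exists 1%N; apply: poly_lt_const; apply: (subring1 dE).
- move=> a b [m ha] [k hb]; exists (maxn m k); apply: poly_ltB.
    exact: (poly_lt_leq (leq_maxl _ _) ha).
  exact: (poly_lt_leq (leq_maxr _ _) hb).
- by move=> a b [m ha] [k hb]; exists (m + k)%N; apply: poly_ltM => //; apply: poly_ltS.
Qed.

Lemma polys_coef e : E e -> polys e.
Proof. by move=> he; exists 1%N; apply: poly_lt_const. Qed.

Lemma polys_var : polys y.
Proof.
exists 2; have := poly_lt_monom 1 (subring1 dE).
by rewrite expr1 mul1r.
Qed.

(** To cancel the leading term [l * y ^+ (k + m)] the quotient must begin with
    [l * e'^-1 * y ^+ k], where [e'] is the conjugate of the leading coefficient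
    [e] of the divisor by [y ^+ k]. *)
Lemma poly_division m k e q p :
  E e -> e != 0 -> poly_lt m q -> poly_lt (k + m) p ->
  exists b r, [/\ poly_lt k b, poly_lt m r & p = b * (e * y ^+ m + q) + r].
Proof.
move=> he e0 hq; elim: k p => [|k IH] p.
  by move=> hp; exists 0, p; rewrite mul0r add0r.
rewrite addSn => -[l [p' [hl hp ->]]].
have [e' he' ee] := normalizesX k yE he.
have e'0 := normalizes_neq0 (divring_exp_neq0 k y0) e0 ee.
pose c := l * e'^-1.
have hc : E c by apply: (subringM dE) => //; apply: divsubV.
have cE : c * y ^+ k * (e * y ^+ m + q) = l * y ^+ (k + m) + c * (y ^+ k * q).
  rewrite mulrDr -!mulrA [_ * (e * _)]mulrA ee -mulrA -exprD.
  by rewrite (divring_mulVK _ e'0).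
have hp2 : poly_lt (k + m) (p' - c * (y ^+ k * q)).
  by apply: poly_ltB => //; apply: poly_ltZ => //; apply: poly_ltXnl.
have [b [r [hb hr eb]]] := IH _ hp2.
exists (c * y ^+ k + b), r; split=> //; first by exists c, b.
rewrite mulrDl cE -addrA -eb -addrA; congr (_ + _).
by rewrite addrC subrK.
Qed.

(** The Euclidean algorithm produces the common multiple: a common multiple of
    the divisor and of the remainder is one of the dividend and the divisor. *)
Lemma polys_left_ore : left_ore polys.
Proof.
suff main m : forall a b, polys a -> poly_lt m b -> b != 0 ->
    exists s r, [/\ polys s, polys r, s != 0 & s * a = r * b].
  by move=> a b ha [m hb]; apply: main hb.
elim: m => [|m IH] a b; first by move=> _ -> /eqP.
move=> ha [e [q [he hq eb]]] b0.
have [e0|e0] := eqVneq e 0.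
  by apply: IH => //; rewrite eb e0 mul0r add0r.
have [k hk] := ha.
have [c [r [hc hr ea]]] := poly_division he e0 hq (poly_lt_leq (leq_addr m k) hk).
rewrite -eb in ea.
have hb : polys b by exists m.+1; exists e, q.
have [r0|r0] := eqVneq r 0.
  exists 1, c; split; first exact: (subring1 polys_subring).
  - by exists k.
  - exact: oner_neq0.
  - by rewrite mul1r ea r0 addr0.
have [s [t [hs ht s0 est]]] := IH b r hb hr r0.
(* [s * b = t * r] makes [t * a] a multiple of [b], and [t] is nonzero. *)
have [t0 _] : t != 0 /\ r != 0.
  by apply: divring_mul_neq0P; rewrite -est divring_mul_neq0.
exists t, (t * c + s); split=> //.
  apply: (subringD polys_subring) => //.
  by apply: (subringM polys_subring) => //; exists k.
by rewrite ea mulrDr -est mulrA -mulrDl.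
Qed.

End Polynomials.
End DivisionSubrings.

(** * Values in a possibly non-abelian ordered group *)

Section Values.
Variables (D : unitRingType) (d : Order.disp_t) (Gamma : orderedGroupType d).
Variable nu : D -> Gamma.
Hypothesis divD : GRing.field_axiom D.
Hypothesis hnu : valuation nu.

(** Ordered groups have no torsion; this is what forces [nu (-1)] to be
    trivial. *)
Lemma ordered_group_sqr1 (g : Gamma) : (g * g = 1)%g -> g = 1%g.
Proof.
move=> gg; apply/le_anti/andP; split; case/orP: (le_total g 1%g) => // h.
  by have := le_mulg2l g _ _ h; rewrite gg mulg1.
by have := le_mulg2l g _ _ h; rewrite gg mulg1.
Qed.

Lemma valuation1 : nu 1 = 1%g.
Proof.
have := valuationM hnu (oner_neq0 D) (oner_neq0 D).
by rewrite mulr1 -[X in X = _]mulg1 => /mulgI <-.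
Qed.

Lemma valuationN (a : D) : a != 0 -> nu (- a) = nu a.
Proof.
move=> a0; have N0 : - 1 != 0 :> D by rewrite oppr_eq0 oner_neq0.
rewrite -mulN1r (valuationM hnu) // (@ordered_group_sqr1 (nu (-1))) ?mul1g //.
by rewrite -(valuationM hnu) // mulrNN mulr1 valuation1.
Qed.

Lemma valuationV (a : D) : a != 0 -> nu a^-1 = (nu a)^-1%g.
Proof.
move=> a0; apply: (@mulIg _ (nu a)).
by rewrite -(valuationM hnu) ?(divring_inv_neq0 divD) // mulVr ?divD // mulVg valuation1.
Qed.

Lemma valuationX (a : D) k : a != 0 -> nu (a ^+ k) = (nu a ^+ k)%g.
Proof.
move=> a0; elim: k => [|k IH]; first by rewrite expr0 expg0 valuation1.
by rewrite exprS expgS (valuationM hnu) ?(divring_exp_neq0 divD) // IH.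
Qed.

Lemma valuationB_lt (a b : D) :
  a != 0 -> b != 0 -> (nu a < nu b)%O -> a - b != 0 /\ nu (a - b) = nu a.
Proof.
move=> a0 b0 lt_ab.
have ab0 : a - b != 0.
  by rewrite subr_eq0; apply: contraTneq lt_ab => ->; rewrite ltxx.
split=> //; apply/le_anti/andP; split.
  have := valuationD hnu ab0 b0; rewrite subrK => /(_ a0).
  by rewrite ge_min [(nu b <= _)%O]leNgt lt_ab orbF.
have Nb0 : - b != 0 by rewrite oppr_eq0.
have := valuationD hnu a0 Nb0 ab0.
by rewrite (valuationN b0) (min_l (ltW lt_ab)).
Qed.

(** The form in which the ultrametric inequality enters below: what is known
    about the value of a difference passes to one of its two terms. *)
Lemma valuationB_neq (a b : D) : a != 0 -> b != 0 -> nu a != nu b ->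
  a - b != 0 /\ (nu (a - b) = nu a \/ nu (a - b) = nu b).
Proof.
move=> a0 b0; case: ltgtP => // [/(valuationB_lt a0 b0)[]|/(valuationB_lt b0 a0)[]].
  by move=> ab0 e _; split; [|left].
move=> ba0 e _; have ab0 : a - b != 0 by rewrite -oppr_eq0 opprB.
by split=> //; right; rewrite -e -(valuationN ba0) opprB.
Qed.

(** If [nu u] and its conjugate [nu v] differ, then one of them is the value of
    [v - u] and commutes with [h]; but an element and its conjugate by [h] are
    equal as soon as one of them commutes with [h]. *)
Lemma commute_of_conjugate (h : Gamma) (u v : D) :
  u != 0 -> v != 0 -> (h * nu u = nu v * h)%g ->
  (v - u != 0 -> commute h (nu (v - u))) -> commute h (nu u).
Proof.
move=> u0 v0 e hvu; have [euv|] := eqVneq (nu v) (nu u).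
  by rewrite /commute e euv.
move=> /(valuationB_neq v0 u0) [vu0 [] eq]; have := hvu vu0; rewrite eq //.
move=> hv; have <- // : nu v = nu u.
by apply: (@mulgI _ h); rewrite e.
Qed.

Definition centralizes (g : Gamma) (S : D -> Prop) : Prop :=
  forall a, S a -> a != 0 -> commute g (nu a).

Definition commuting_values (S : D -> Prop) : Prop :=
  forall a, S a -> a != 0 -> centralizes (nu a) S.

Lemma centralizes_fractions g S :
  centralizes g S -> centralizes g (fractions S).
Proof.
move=> h _ [s [b [hs hb s0 ->]]] sb0.
have [_ b0] := divring_mul_neq0P sb0.
rewrite (valuationM hnu) ?(divring_inv_neq0 divD) // valuationV //.
by apply: commuteM; [apply/commuteV/h | apply: h].
Qed.

Lemma commuting_fractions S :
  commuting_values S -> commuting_values (fractions S).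
Proof.
move=> h a ha a0; apply: centralizes_fractions => b hb b0.
by apply/commute_sym/(centralizes_fractions (h b hb b0)).
Qed.

(** * Values of polynomials *)

Section PolynomialValues.
Variables (E : D -> Prop) (y : D).
Hypothesis dE : division_subring E.
Hypothesis y0 : y != 0.
Hypothesis yE : normalizes y E.
Hypothesis nuE : commuting_values E.
Hypothesis nuyE : centralizes (nu y) E.

Lemma valuation_twist k e e' : E e -> e != 0 -> y ^+ k * e = e' * y ^+ k ->
  e' != 0 /\ nu e' = nu e.
Proof.
move=> he e0 eq; have yk0 := divring_exp_neq0 divD k y0.
have e'0 := normalizes_neq0 divD yk0 e0 eq; split=> //.
apply: (@mulIg _ (nu (y ^+ k))).
rewrite -(valuationM hnu) // -eq (valuationM hnu) // valuationX //.
by apply/commute_sym/commuteX/commute_sym/nuyE.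
Qed.

(** Induction on the degree of [a], after the division [p * a = b * p + r] of
    [p * a] by [p] on the right. *)
Lemma monic_centralizes m q : poly_lt E y m q -> y ^+ m + q != 0 ->
  commuting_values (poly_lt E y m) ->
  forall k, (k <= m)%N -> centralizes (nu (y ^+ m + q)) (poly_lt E y k).
Proof.
move=> hq; set p := y ^+ m + q => p0 comm; elim=> [|k IH] km a.
  by move=> -> /eqP.
move=> [l [a' [hl ha' ea]]] a0.
have [l0|l0] := eqVneq l 0.
  by apply: (IH (ltnW km)) => //; rewrite ea l0 mul0r add0r.
have ha : poly_lt E y m a.
  by apply: (poly_lt_leq dE km); exists l, a'.
have [l' hl' el] := normalizesX m yE hl.
have [l'0 nul] := valuation_twist hl l0 el.
(* Both products start with [l' * y ^+ (k + m)], so the quotient [b] of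
   [p * a] by [p] has leading term [l' * y ^+ k]. *)
have hr : poly_lt E y (k + m) (p * a - l' * y ^+ k * p).
  have -> : p * a = l' * y ^+ (k + m) + (y ^+ m * a' + q * a).
    by rewrite mulrDl {1}ea mulrDr mulrA el -mulrA -exprD addnC addrA.
  have -> : l' * y ^+ k * p = l' * y ^+ (k + m) + l' * (y ^+ k * q).
    by rewrite mulrDr -!mulrA -exprD.
  rewrite opprD addrACA subrr add0r; apply: (poly_ltB dE); last first.
    by apply: (poly_ltZ dE) => //; apply: (poly_ltXnl dE).
  rewrite addnC; apply: (poly_ltD dE); first exact: (poly_ltXnl dE).
  by apply: (poly_ltM dE) => //; exists l, a'.
have := poly_division divD dE y0 yE (subring1 dE) (oner_neq0 D) hq hr.
rewrite mul1r -/p => -[b' [r [hb' hr' er]]].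
pose b := l' * y ^+ k + b'.
have epa : p * a - b * p = r.
  by rewrite [b * p]mulrDl opprD addrA er addrC addKr.
have pa0 : p * a != 0 by apply: divring_mul_neq0.
have hb : poly_lt E y m b by apply: (poly_lt_leq dE km); exists l', b'.
have nupa : nu (p * a) = (nu p * nu a)%g by apply: (valuationM hnu).
have [b0|b0] := eqVneq b 0.
  move: epa; rewrite b0 mul0r subr0 => epa.
  have -> : nu p = (nu r * (nu a)^-1)%g by rewrite -epa nupa mulgK.
  apply/commute_sym/commuteM; last exact/commuteV/commute_refl.
  by apply: comm => //; rewrite -epa.
have bp0 : b * p != 0 by apply: divring_mul_neq0.
have nubp : nu (b * p) = (nu b * nu p)%g by apply: (valuationM hnu).
have [enu|/(valuationB_neq pa0 bp0)[r0]] := eqVneq (nu (p * a)) (nu (b * p)).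
  (* Scaling [b] by [s], of trivial value, gives it the leading term of [a]. *)
  pose s := l * l'^-1.
  have hs : E s by apply: (subringM dE) => //; apply: (divsubV dE).
  have s0 : s != 0 by rewrite divring_mul_neq0 // (divring_inv_neq0 divD).
  have nus : nu s = 1%g.
    by rewrite (valuationM hnu) ?(divring_inv_neq0 divD) // valuationV // nul mulgV.
  apply: (@commute_of_conjugate _ a (s * b)) => //.
  - exact: divring_mul_neq0.
  - by rewrite (valuationM hnu) // nus mul1g -nupa -nubp.
  - apply: (IH (ltnW km)).
    have -> : s * b - a = s * b' - a'.
      rewrite /b mulrDr mulrA /s mulrVK ?divD // ea opprD addrACA subrr add0r //.
    by apply: (poly_ltB dE) => //; apply: (poly_ltZ dE).
(* Now [nu r] is one of two distinct values, so that [nu p] is a quotient of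
   values of elements of degree less than [m]. *)
rewrite epa in r0 * => -[] enu.
  have -> : nu p = (nu r * (nu a)^-1)%g by rewrite enu nupa mulgK.
  apply/commute_sym/commuteM; last exact/commuteV/commute_refl.
  exact: comm.
have -> : nu p = ((nu b)^-1 * nu r)%g by rewrite enu nubp mulKg.
by apply/commute_sym/commuteM; [apply/commuteV|]; apply: comm.
Qed.

(** The difference of two monic elements of the same degree has smaller degree,
    so two distinct values of such elements cannot both be new. *)
Lemma commuting_poly_lt m : commuting_values (poly_lt E y m).
Proof.
(* Constants form a separate base case: their values commute by the hypothesis
   on [E], and for [k > 0] they have degree less than [k]. *)
elim: m => [|[|m] IH]; first by move=> a -> /eqP.
  move=> _ [e [_ [he -> ->]]] e0 _ [e' [_ [he' -> ->]]].
  rewrite !expr0 !mulr1 !addr0 in e0 * => e'0; exact: nuE.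
set k := m.+1 in IH *.
have hE e : E e -> poly_lt E y k e by apply: poly_lt_const.
have monic e q : e != 0 -> e * y ^+ k + q = e * (y ^+ k + e^-1 * q).
  by move=> e0; rewrite mulrDr mulVKr ?divD.
(* It is enough to compare two elements that are monic of degree [k]. *)
suff mm q q' : poly_lt E y k q -> poly_lt E y k q' ->
    y ^+ k + q != 0 -> y ^+ k + q' != 0 ->
    commute (nu (y ^+ k + q)) (nu (y ^+ k + q')).
  have low a : poly_lt E y k a -> a != 0 -> centralizes (nu a) (poly_lt E y k.+1).
    move=> ha a0 _ [e [q [he hq ->]]].
    have [->|e0] := eqVneq e 0; first by rewrite mul0r add0r; apply: IH.
    rewrite monic // => /(divring_mul_neq0P)[_ p0]; rewrite (valuationM hnu) //.
    apply: commuteM; first by apply: IH => //; apply: hE.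
    apply/commute_sym; apply: (monic_centralizes _ p0 IH (leqnn k)) => //.
    by apply: (poly_ltZ dE) => //; apply: (divsubV dE).
  move=> _ [e [q [he hq ->]]].
  have [->|e0] := eqVneq e 0; first by rewrite mul0r add0r; apply: low.
  have hq1 : poly_lt E y k (e^-1 * q).
    by apply: (poly_ltZ dE) => //; apply: (divsubV dE).
  rewrite monic // => /(divring_mul_neq0P)[_ p0] b hb b0.
  rewrite (valuationM hnu) //; apply/commute_sym/commuteM.
    by apply/commute_sym; apply: (low e (hE _ he) e0).
  case: hb b0 => e' [q' [he' hq' ->]].
  have [->|e'0] := eqVneq e' 0.
    rewrite mul0r add0r => q'0; apply/commute_sym.
    exact: (monic_centralizes hq1 p0 IH (leqnn k)).
  rewrite monic // => /(divring_mul_neq0P)[_ p'0]; rewrite (valuationM hnu) //.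
  apply/commute_sym/commuteM.
    by apply: (monic_centralizes hq1 p0 IH (leqnn k)) => //; apply: hE.
  by apply: mm => //; apply: (poly_ltZ dE) => //; apply: (divsubV dE).
move=> hq hq' p0 p'0.
have [->|] := eqVneq (nu (y ^+ k + q)) (nu (y ^+ k + q')).
  exact: commute_refl.
move=> /(valuationB_neq p0 p'0).
rewrite opprD addrACA subrr add0r => -[r0 enu].
have hr : poly_lt E y k (q - q') by apply: (poly_ltB dE).
case: enu => enu.
  apply/commute_sym; rewrite -enu.
  exact: (monic_centralizes hq' p'0 IH (leqnn k)).
by rewrite -enu; apply: (monic_centralizes hq p0 IH (leqnn k)).
Qed.

Lemma commuting_polys : commuting_values (polys E y).
Proof.
move=> a [m ha] a0 b [k hb] b0.
apply: (@commuting_poly_lt (maxn m k)) => //.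
  exact: (poly_lt_leq dE (leq_maxl _ _) ha).
exact: (poly_lt_leq dE (leq_maxr _ _) hb).
Qed.

Section SecondElement.
Variables z c : D.
Hypothesis z0 : z != 0.
Hypothesis zE : normalizes z E.
Hypothesis cE : E c.
Hypothesis zy : z * y = c * y * z.

Lemma twist_var k : exists2 s, E s & z * y ^+ k = s * y ^+ k * z.
Proof.
elim: k => [|k [s hs IH]].
  by exists 1; [apply: (subring1 dE) | rewrite expr0 !mulr1 mul1r].
have [s' hs' es] := yE hs.
exists (c * s'); first exact: (subringM dE).
by rewrite exprS mulrA zy -mulrA IH !mulrA -(mulrA c y s) es !mulrA -(mulrA _ y).
Qed.

Lemma normalizes_poly_lt m : normalizes z (poly_lt E y m).
Proof.
elim: m => [|m IH] p; first by move=> ->; exists 0; rewrite ?mulr0 ?mul0r.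
move=> [e [q [he hq ->]]].
have [e' he' ee] := zE he; have [q' hq' eq] := IH _ hq.
have [s hs es] := twist_var m.
exists (e' * s * y ^+ m + q').
  by exists (e' * s), q'; split=> //; apply: (subringM dE).
by rewrite mulrDr mulrDl -eq mulrA ee -mulrA es !mulrA.
Qed.

Lemma normalizes_polys : normalizes z (polys E y).
Proof.
move=> a [m ha]; have [b hb e] := normalizes_poly_lt ha.
by exists b => //; exists m.
Qed.

Hypothesis nuzE : centralizes (nu z) E.
Hypothesis nuzy : commute (nu z) (nu y).

(** Conjugation by [z] preserves the degree and multiplies the leading
    coefficient by an element of trivial value, so [commute_of_conjugate]
    applies after rescaling. *)
Lemma centralizes_poly_lt m : centralizes (nu z) (poly_lt E y m).
Proof.
elim: m => [|m IH] p; first by move=> -> /eqP.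
move=> [e [q [he hq ->]]].
have [->|e0] := eqVneq e 0; first by rewrite mul0r add0r; apply: IH.
set p1 := (X in X != 0 -> _) => p0.
have [e' he' ee] := zE he; have [q' hq' eq] := normalizes_poly_lt hq.
have [s hs es] := twist_var m.
have ym0 := divring_exp_neq0 divD m y0.
pose l := e' * s.
have el : z * (e * y ^+ m) = l * y ^+ m * z by rewrite mulrA ee -mulrA es !mulrA.
have eym0 : e * y ^+ m != 0 by apply: divring_mul_neq0.
have lym0 := normalizes_neq0 divD z0 eym0 el.
have [l0 _] := divring_mul_neq0P lym0.
have hl : E l by apply: (subringM dE).
clearbody l.
have nul : nu l = nu e.
  have := congr1 nu el; rewrite !(valuationM hnu) // => /esym.
  have -> : (nu z * (nu e * nu (y ^+ m)) = nu e * nu (y ^+ m) * nu z)%g.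
    apply: commuteM; first exact: nuzE.
    by rewrite valuationX //; apply: commuteX.
  by move=> /mulIg/mulIg.
pose t := e * l^-1.
have ht : E t by apply: (subringM dE) => //; apply: (divsubV dE).
have t0 : t != 0 by rewrite divring_mul_neq0 // (divring_inv_neq0 divD).
have nut : nu t = 1%g.
  by rewrite (valuationM hnu) ?(divring_inv_neq0 divD) // valuationV // nul mulgV.
have ep : z * p1 = (l * y ^+ m + q') * z by rewrite mulrDr mulrDl el eq.
have p'0 := normalizes_neq0 divD z0 p0 ep.
apply: (@commute_of_conjugate _ p1 (t * (l * y ^+ m + q'))) => //.
- exact: divring_mul_neq0.
- by rewrite (valuationM hnu) // nut mul1g -!(valuationM hnu) // ep.
- apply: IH; rewrite mulrDr mulrA /t mulrVK ?divD // opprD addrACA subrr add0r.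
  by apply: (poly_ltB dE) => //; apply: (poly_ltZ dE).
Qed.

Lemma centralizes_polys : centralizes (nu z) (polys E y).
Proof. by move=> a [m ha]; apply: centralizes_poly_lt ha. Qed.
End SecondElement.

End PolynomialValues.

(** * Adjoining one element at a time *)

(** The invariant of the tower.  Normalization and commutation are required for
    all [xs i], not only for the next one to be adjoined, so that
    the invariant is available again for the elements that come later. *)
Record adapted (I : Type) (xs : I -> D) (E : D -> Prop) : Prop := {
  adapted_division :> division_subring E;
  adapted_commuting : commuting_values E;
  adapted_normalizes : forall i, normalizes (xs i) E;
  adapted_centralizes : forall i, centralizes (nu (xs i)) E
}.

Lemma adapted_adjoin (I : Type) (xs : I -> D) (E : D -> Prop) (k : I) :
  (forall i, xs i != 0) ->
  (forall i, commute (nu (xs i)) (nu (xs k))) ->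
  (forall i, exists2 c, E c & xs i * xs k = c * xs k * xs i) ->
  adapted xs E -> adapted xs (fractions (polys E (xs k))).
Proof.
move=> x0 nux xx [dE nuE xE nuxE].
have yE := xE k.
split.
- apply: fractions_division_subring => //; first exact: polys_subring.
  exact: polys_left_ore.
- by apply: commuting_fractions; apply: commuting_polys.
- move=> i; apply: normalizes_fractions => //.
  have [c cE e] := xx i; exact: (normalizes_polys dE yE (xE i) cE e).
- move=> i; apply: centralizes_fractions; have [c cE e] := xx i.
  exact: (centralizes_polys dE (x0 k) yE (x0 i) (xE i) cE e).
Qed.

End Values.

(** * The skew PBW extension *)

Lemma prod_eq0_seq (B : nzRingType) (I : eqType) (r : seq I) (F : I -> B) i :
  i \in r -> F i = 0 -> \prod_(j <- r) F j = 0.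
Proof.
elim: r => //= j r IH; rewrite inE big_cons => /predU1P[<- ->|ir Fi].
  by rewrite mul0r.
by rewrite IH // mulr0.
Qed.

(** Otherwise the standard monomial with all exponents 1 would vanish, against
    freeness. *)
Lemma skew_PBW_var_neq0 (R : nzRingType) (A : lalgType R) (n : nat)
  (x : 'I_n -> A) (i : 'I_n) : skew_PBW_extension x -> x i != 0.
Proof.
move=> hA; apply/eqP => xi0.
have [free _] := skewPBW_basis hA.
pose u : {ffun 'I_n -> nat} := [ffun j => 1%N].
have u0 : standard_monomial x u = 0.
  by apply: (@prod_eq0_seq _ _ _ _ i); rewrite ?mem_index_enum // ffunE expr1.
have := free [:: u] (fun _ => 1) isT; rewrite big_seq1 u0 scaler0.
by move=> /(_ erefl u (mem_head _ _))/eqP; rewrite oner_eq0.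
Qed.

Section Tower.
Variables (R : nzRingType) (A : lalgType R) (n : nat) (x : 'I_n -> A).
Hypotheses (hA : skew_PBW_extension x) (hqc : quasi_commutative x).
Hypothesis hR : left_ore_domain R.
Variables (QA : unitRingType) (f : {rmorphism A -> QA}).
Hypothesis hQA : division_ring_of_fractions f.
Variables (d : Order.disp_t) (Gamma : orderedGroupType d) (nu : QA -> Gamma).
Hypothesis hnu : valuation nu.
Hypothesis hnuR : forall q : QA, left_fraction (fun r : R => f r%:A) q ->
  q != 0 -> nu q = 1%g.

Let divQ : GRing.field_axiom QA := fractions_division_ring hQA.

Lemma generator_neq0 i : f (x i) != 0.
Proof.
rewrite -(rmorph0 f) (inj_eq (fractions_injective hQA)).
exact: skew_PBW_var_neq0.
Qed.

Definition scalars (q : QA) : Prop := exists r : R, q = f r%:A.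

Lemma scalars_eq0 (r : R) : (f r%:A == 0) = (r == 0).
Proof.
rewrite -(rmorph0 f) (inj_eq (fractions_injective hQA)).
by rewrite -(inj_eq (skewPBW_subring hA) r 0) scale0r.
Qed.

Lemma scalarsM (r s : R) : f r%:A * f s%:A = f (r * s)%:A.
Proof. by rewrite -rmorphM mulr_algl scalerA. Qed.

Lemma scalars_subring : subring scalars.
Proof.
split.
- by exists 1; rewrite scale1r rmorph1.
- by move=> _ _ [r ->] [s ->]; exists (r - s); rewrite scalerBl rmorphB.
- by move=> _ _ [r ->] [s ->]; exists (r * s); rewrite scalarsM.
Qed.

Lemma scalars_left_ore : left_ore scalars.
Proof.
move=> _ _ [a ->] [b ->]; rewrite scalars_eq0 => b0.
have [->|a0] := eqVneq a 0.
  exists 1, 0; split; first exact: (subring1 scalars_subring).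
  - exact: (subring0 scalars_subring).
  - exact: oner_neq0.
  - by rewrite mul1r mul0r scale0r rmorph0.
have [r [s [e ra0]]] := hR.2 a b a0 b0.
exists (f r%:A), (f s%:A); split; [by exists r | by exists s | |].
  by rewrite scalars_eq0; apply: contraNneq ra0 => ->; rewrite mul0r.
by rewrite !scalarsM e.
Qed.

Lemma valuation_fractions_scalars (q : QA) :
  fractions scalars q -> q != 0 -> nu q = 1%g.
Proof.
move=> [_ [_ [[s ->] [b ->] s0 e]]]; apply: hnuR.
by exists s, b; rewrite -scalars_eq0.
Qed.

Lemma adapted_scalars : adapted nu (f \o x) (fractions scalars).
Proof.
split.
- exact: (fractions_division_subring divQ scalars_subring scalars_left_ore).
- move=> a ha a0 b hb b0; rewrite (valuation_fractions_scalars ha a0).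
  exact/commute_sym/commute1.
- move=> i /=; apply: (normalizes_fractions divQ); first exact: generator_neq0.
  move=> _ [r ->]; have [->|r0] := eqVneq r 0.
    exists 0; first exact: (subring0 scalars_subring).
    by rewrite scale0r rmorph0 mulr0 mul0r.
  have [c [_ e]] := hqc.1 i r r0.
  by exists (f c%:A); [exists c | rewrite -!rmorphM e].
- move=> i a ha a0; rewrite (valuation_fractions_scalars ha a0); exact: commute1.
Qed.

Lemma generators_twist i j : exists c : R, c != 0 /\
  f (x i) * f (x j) = f c%:A * f (x j) * f (x i).
Proof.
have [c [c0 e]] := hqc.2 j i; exists c; split=> //.
by rewrite -!rmorphM e.
Qed.

(** [f (x i) * f (x j)] and [f (x j) * f (x i)] differ by a nonzero scalar,
    which has trivial value. *)
Lemma generators_commuting_values i j : commute (nu (f (x i))) (nu (f (x j))).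
Proof.
have [c [c0 e]] := generators_twist i j.
have fc0 : f c%:A != 0 by rewrite scalars_eq0.
have nuc : nu (f c%:A) = 1%g.
  apply: valuation_fractions_scalars => //; apply: (fractions_sub scalars_subring).
  by exists c.
have [xi0 xj0] := (generator_neq0 i, generator_neq0 j).
rewrite /commute -(valuationM hnu) // e !(valuationM hnu) //.
  by rewrite nuc mul1g.
exact: (divring_mul_neq0 divQ).
Qed.

Lemma adapted_tower k : (k <= n)%N ->
  exists E, [/\ adapted nu (f \o x) E, forall r : R, E (f r%:A) &
    forall i : 'I_n, (i < k)%N -> E (f (x i))].
Proof.
elim: k => [|k IH] kn.
  exists (fractions scalars); split=> //; first exact: adapted_scalars.
  by move=> r; apply: (fractions_sub scalars_subring); exists r.
have [E [aE RE xE]] := IH (ltnW kn).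
pose y := f (x (Ordinal kn)).
have sP : subring (polys E y).
  exact: (polys_subring aE (adapted_normalizes aE (Ordinal kn))).
have EP e : E e -> fractions (polys E y) e.
  by move=> he; apply: (fractions_sub sP); apply: (polys_coef y aE).
exists (fractions (polys E y)); split.
- apply: (adapted_adjoin (xs := f \o x) divQ hnu (k := Ordinal kn)) => //.
  + exact: generator_neq0.
  + by move=> i; apply: generators_commuting_values.
  + move=> i; have [c [_ e]] := generators_twist i (Ordinal kn).
    by exists (f c%:A).
- by move=> r; apply: EP.
- move=> i; rewrite ltnS leq_eqVlt => /predU1P[ik|ik]; last exact/EP/xE.
  have -> : i = Ordinal kn by apply: val_inj.
  exact/(fractions_sub sP)/(polys_var y aE).
Qed.

Lemma fractions_commuting_values (p q : QA) :
  p != 0 -> q != 0 -> commute (nu p) (nu q).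
Proof.
have [E [aE RE xE]] := adapted_tower (leqnn n).
have AE (a : A) : E (f a).
  have [s [c [_ ->]]] := (skewPBW_basis hA).2 a.
  rewrite rmorph_sum; apply: (subring_sum aE) => u.
  rewrite -mulr_algl rmorphM rmorph_prod; apply: (subringM aE) => //.
  apply: (subring_prod aE) => i; rewrite rmorphXn.
  by apply: (subringX aE); apply: xE.
have EQ (r : QA) : E r.
  have [s [b [_ ->]]] := fractions_surjective hQA r.
  by apply: (subringM aE) => //; apply: (divsubV aE).
by move=> p0 q0; apply: (adapted_commuting aE).
Qed.
End Tower.

Theorem theorem3p31 (R : nzRingType) (A : lalgType R) (n : nat)
    (x : 'I_n -> A)
    (hA : skew_PBW_extension x)
    (hbij : bijective_extension x)
    (hqc : quasi_commutative x)
    (hR : left_ore_domain R)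
    (QA : unitRingType) (f : {rmorphism A -> QA})
    (hQA : division_ring_of_fractions f)
    (d : Order.disp_t) (Gamma : orderedGroupType d) (nu : QA -> Gamma)
    (hnu : valuation nu)
    (hnuR : forall q : QA, left_fraction (fun r : R => f r%:A) q ->
       q != 0 -> nu q = 1%g) :
  forall g h : Gamma, (g * h)%g = (h * g)%g.
Proof.
move=> g h.
have [[p [p0 <-]] [q [q0 <-]]] := (valuation_surj hnu g, valuation_surj hnu h).
exact: (fractions_commuting_values hA hqc hR hQA hnu hnuR).
Qed.
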